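(* Let $B\in\mathbb{C}\setminus\{0\}$ and consider the rational difference equation $$z_{n+1}=\frac{z_{n-1}}{1+Bz_{n}-Bz_{n-1}},\quad n=0,1,\dots,$$ with initial conditions $z_{0},z_{-1}\in\mathbb{C}$. Then its forbidden set $\mathfrak{F}$ (a set of pairs $(z_0,z_{-1})$) equals $$S_{2}=\left\{\left(\tfrac{-1}{B},0\right)\right\}\cup\left\{\left(0,\tfrac{1}{Bn}\right)\,\middle|\,n\in\mathbb{N}\right\}\cup\left\{\left(\tfrac{1}{Bn},0\right)\,\middle|\,n\in\mathbb{N}\right\}$$ $$\cup\bigcup_{\delta\in\mathbb{C}\setminus\left((-\infty,-\frac14]\cup\{0\}\right)}\left\{\left(a,\frac{Ba+1}{\delta B^{2}a}\right)\,\middle|\,a\in P_\delta\setminus\left\{0,\tfrac{-1}{B}\right\}\right\}\cup\bigcup_{\delta\in(-\infty,-\frac14)}\left\{\left(a,\frac{Ba+1}{\delta B^{2}a}\right)\,\middle|\,a\in Q_\delta\setminus\left\{0,\tfrac{-1}{B}\right\}\right\}$$ $$\cup\left\{\left(a,\frac{-4Ba-4}{B^{2}a}\right)\,\middle|\,a\in\left\{\tfrac{-2n-2}{Bn}\,\middle|\,n\in\mathbb{N}\right\}\setminus\left\{0,\tfrac{-1}{B}\right\}\right\},$$ where $$P_\delta=\left\{\frac{2}{B}\left(\frac{\left(1+\sqrt{1+4\delta}\right)^{n-1}-\left(1-\sqrt{1+4\delta}\right)^{n-1}}{\left(1+\sqrt{1+4\delta}\right)^{n}-\left(1-\sqrt{1+4\delta}\right)^{n}}\right)+\frac{1}{\delta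 B}\,\middle|\,n\in\mathbb{N}\right\},$$ $$Q_\delta=\left\{\frac{-1}{2\delta B}\left(-1-\sqrt{-4\delta-1}\,\cot\left(n\arccos\left(\tfrac{1}{2\sqrt{-\delta}}\right)\right)\right)\,\middle|\,n\in\mathbb{N},\ n\arccos\left(\tfrac{1}{2\sqrt{-\delta}}\right)\notin\pi\mathbb{Z}\right\}.$$ Moreover, given $(z_{0},z_{-1})\notin\mathfrak{F}$, there are four possibilities: (i) $z_{0}=0$, in which case $z_{2n}=0$ for all $n\geq 0$ and $z_{2n+1}=\frac{z_{2n-1}}{1-Bz_{2n-1}}$ for all $n\geq 0$. This implies $$z_{2n+1}=\frac{1}{-B}\left(\frac{1-(n+2)Bz_{-1}}{1-(n+1)Bz_{-1}}\right)+\frac{1}{B},\quad n\geq -1.$$ (ii) $z_{-1}=0$, in which case $z_{2n+1}=0$ for all $n\geq 0$ and $z_{2n}=\frac{z_{2n-2}}{1-Bz_{2n-2}}$ for all $n\geq 1$. This implies $$z_{2n}=\frac{1}{-B}\left(\frac{1-(n+1)Bz_{0}}{1-nBz_{0}}\right)+\frac{1}{B},\quad n\geq 0.$$ (iii) $z_{0}=\frac{-1}{B}$, in which case $z_{n}=\frac{-1}{B}$ for all $n\geq 0$. (iv) $z_{0}\neq 0,\frac{-1}{B}$ and $z_{-1}\neq 0$, in which case $z_{n+1}=\frac{1}{Cz_{n}-B}$ for all $n\geq 0$, where $C=\left(\frac{1}{z_{0}}+B\right)\left(\frac{1}{z_{-1}}\right)$. This implies the following: (a) If $\frac{-C}{B^{2}}\in\mathbb{C}\setminus\left[\frac14,\infty\right)$,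 then with $\lambda_{1}=\frac{1-\sqrt{1+\frac{4C}{B^{2}}}}{2}$ and $\lambda_{2}=\frac{1+\sqrt{1+\frac{4C}{B^{2}}}}{2}$, $$z_{n}=\frac{-B}{C}\left(\frac{(B\lambda_{2}+Cz_{0}-B)\lambda_{1}^{n+1}+(B-Cz_{0}-B\lambda_{1})\lambda_{2}^{n+1}}{(B\lambda_{2}+Cz_{0}-B)\lambda_{1}^{n}+(B-Cz_{0}-B\lambda_{1})\lambda_{2}^{n}}\right)+\frac{B}{C},\quad n\geq 0.$$ (b) If $\frac{-C}{B^{2}}=\frac14$, then $$z_{n}=\frac{-B}{C}\left(\frac{-B+(n+1)(2Cz_{0}-B)}{-2B+4nCz_{0}-2nB}\right)+\frac{B}{C},\quad n\geq 0.$$ (c) If $\frac{-C}{B^{2}}\in\left(\frac14,\infty\right)$, then with $D=B\sqrt{\frac{-4C}{B^{2}}-1}$ and $\rho=\arccos\left(\sqrt{\frac{-B^{2}}{4C}}\right)$, for all $n\geq 0$, $$z_{n}=\sqrt{\frac{-B^{2}}{C}}\left(\frac{D\cos((n+1)\rho)+(B-2Cz_{0})\sin((n+1)\rho)}{BD\cos(n\rho)+(B^{2}-2CBz_{0})\sin(n\rho)}\right)+\frac{B}{C}.$$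
   Context: The forbidden set $\mathfrak{F}$ of a second order rational difference equation is the set of initial conditions, written as pairs $(z_{0},z_{-1})\in\mathbb{C}^{2}$ in this order, for which the iteration eventually requires a division by zero (so that $z_n$ is not well defined for some $n\ge 1$; $0/0$ counts as undefined). $\mathbb{N}=\{1,2,3,\dots\}$. $\sqrt{\cdot}$ is the principal complex square root, with branch cut along the negative real numbers; $\arccos$ is the usual real arccosine. *)

(* Defs.v *)
From HB Require Import structures.
From mathcomp Require Import all_boot all_order all_algebra.
From mathcomp Require Import all_classical all_reals all_analysis.
From mathcomp Require Import complex.

Set Implicit Arguments.
Unset Strict Implicit.
Unset Printing Implicit Defensive.

Import Order.TTheory GRing.Theory Num.Theory.

Local Open Scope classical_set_scope.
Local Open Scope ring_scope.
Local Open Scope complex_scope.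

(* The complex numbers are R[i] with R : realType. [sqrtc] is the principal
   square root: Re (sqrtc x) >= 0, and sqrtc x = i * sqrt |x| for real x < 0. *)

Section Difference_equation.
Variable R : realType.
Implicit Types (B d : R[i]) (p : R[i] * R[i]).

(* One step (z_n, z_(n-1)) |-> (z_(n+1), z_n) of the iteration
   z_(n+1) = z_(n-1) / (1 + B z_n - B z_(n-1)); the value is None exactly when
   the step divides by zero (0 / 0 included). *)
Definition step B p : option (R[i] * R[i]) :=
  if 1 + B * p.1 - B * p.2 == 0 then None
  else Some (p.2 / (1 + B * p.1 - B * p.2), p.1).

Definition orbit B p (n : nat) : option (R[i] * R[i]) :=
  iter n (obind (step B)) (Some p).

(* Initial conditions are ordered as (z_0, z_(-1)). *)
Definition forbidden_set B : set (R[i] * R[i]) :=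
  [set p | exists n : nat, orbit B p n = None].

(* Only z_(-1), z_0, z_1, ... are constrained. As x / 0 = 0 in R[i], such a
   z exists for all initial conditions, but it is the sequence produced by the
   iteration only when (z_0, z_(-1)) is not in the forbidden set. *)
Definition is_solution B (z : int -> R[i]) : Prop :=
  forall n : nat,
    z (n%:Z + 1) = z (n%:Z - 1) / (1 + B * z n%:Z - B * z (n%:Z - 1)).

Definition cot (x : R) : R := cos x / sin x.

Definition real_interval (I : interval R) : set R[i] :=
  [set t%:C | t in [set` I]].

Definition positive_nat : set nat := [set n | (0 < n)%N].

Definition P B d : set R[i] :=
  [set 2 / B * (((1 + sqrtc (1 + 4 * d)) ^+ (n - 1)
                 - (1 - sqrtc (1 + 4 * d)) ^+ (n - 1))
              / ((1 + sqrtc (1 + 4 * d)) ^+ n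
                 - (1 - sqrtc (1 + 4 * d)) ^+ n))
       + 1 / (d * B) | n in positive_nat].

(* Used for real d < -1/4, so that all square roots are of positive reals. *)
Definition Q B (d : R) : set R[i] :=
  let theta := acos (1 / (2 * Num.sqrt (- d))) in
  [set - 1 / (2 * d%:C * B)
       * (- 1 - (Num.sqrt (- 4 * d - 1))%:C * (cot (n%:R * theta))%:C)
   | n in [set n | positive_nat n /\
                   ~ exists k : int, n%:R * theta = k%:~R * pi]].

Definition S2 B : set (R[i] * R[i]) :=
  [set (- 1 / B, 0)]
  `|` [set (0, 1 / (B * n%:R)) | n in positive_nat]
  `|` [set (1 / (B * n%:R), 0) | n in positive_nat]
  `|` \bigcup_(d in ~` (real_interval `]-oo, (- (1 / 4))] `|` [set 0]))
        [set (a, (B * a + 1) / (d * B ^+ 2 * a))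
         | a in P B d `\` [set 0; - 1 / B]]
  `|` \bigcup_(d in [set` `]-oo, (- (1 / 4) : R)[])
        [set (a, (B * a + 1) / (d%:C * B ^+ 2 * a))
         | a in Q B d `\` [set 0; - 1 / B]]
  `|` [set (a, (- 4 * B * a - 4) / (B ^+ 2 * a))
       | a in [set (- 2 * n%:R - 2) / (B * n%:R) | n in positive_nat]
              `\` [set 0; - 1 / B]].

End Difference_equation.

(* Main.v *)
Require Import Defs.
From HB Require Import structures.
From mathcomp Require Import all_boot all_order all_algebra.
From mathcomp Require Import all_classical all_reals all_analysis.
From mathcomp Require Import complex ring lra zify.

Import Order.TTheory GRing.Theory Num.Theory.

Local Open Scope classical_set_scope.
Local Open Scope ring_scope.
Local Open Scope complex_scope.

(** The iteration has a conserved quantity: along an orbit that avoids 0 and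
    [- 1 / B], the number [C = (1 / z_n + B) / z_(n-1)] does not depend on [n].
    With [d = C / B ^+ 2], its level set is the curve of the points
    [(x, (B x + 1) / (d B^2 x))], and the second order iteration restricted to
    it is the Moebius map [x |-> 1 / (C x - B)] in the first coordinate
    ([step_curve]).

    A Moebius map is linearized by writing its variable as a quotient. Put
    [x_n = (1 - q_(n+1) / q_n) / (d B)]; then the [q_n] satisfy
    [q_(n+2) = q_(n+1) + d q_n] with [q_0 = 1] and [q_1 = 1 - d B z_0], and the
    iteration breaks down exactly when some [q_n] with [n > 0] vanishes
    ([curve_orbit], [forbidden_curve]). Everything about the generic case is
    thus a statement on this linear recurrence. Its characteristic polynomial
    [l^2 - l - d] has discriminant [1 + 4 d], and the three families of
    formulas correspond to the position of the discriminant: distinct roots of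
    distinct moduli outside [(-oo, 0]] ([linrec_binet]), a double root at 0
    ([linrec_double_root]), and conjugate roots of argument
    [acos (1 / (2 sqrt (- d)))] on the negative half-line ([linrec_trig]).
    Solving [q_n = 0] for [z_0] in each of them gives the sets of the forbidden
    set ([mem_P], [mem_Q], [mem_double_root]); substituting them in
    [q_(n+1) / q_n] gives the closed forms of the solutions.

    The remaining initial conditions lie on the lines [z_0 = 0], [z_(-1) = 0]
    and [z_0 = - 1 / B]. The first two are exchanged by one step, and every
    second term vanishes while the others satisfy
    [1 / z_(n+1) = 1 / z_(n-1) - B], or all vanish ([axis_orbit]); the
    third collapses to a fixed point, unless [z_(-1) = 0]
    ([step_fixed_line]). *)

Set Implicit Arguments.
Unset Strict Implicit.

(** * A second order linear recurrence *)

Fixpoint linrec {F : fieldType} (d x y : F) (n : nat) : F :=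
  if n is m.+1 then linrec d y (y + d * x) m else x.

Lemma linrecSS (F : fieldType) (d x y : F) n :
  linrec d x y n.+2 = linrec d x y n.+1 + d * linrec d x y n.
Proof. by elim: n x y => [//|n IHn] x y; apply: IHn. Qed.

(** Solutions of a recurrence whose characteristic roots are [c] times those of
    [l^2 - l - d]. The dilation factor [c] absorbs the powers that the closed
    forms below carry: [c = 2] for the double root [1 / 2], and
    [c = 1 / sqrt s] for the conjugate roots of modulus [sqrt s]. *)
Lemma rescaled_linrec (F : fieldType) (d k c x y : F) (w : nat -> F) :
  w 0%N = k * x -> w 1%N = k * c * y ->
  (forall n, w n.+2 = c * w n.+1 + c ^+ 2 * d * w n) ->
  forall n, w n = k * c ^+ n * linrec d x y n.
Proof.
move=> w0 w1 wE n.
suff [] : w n = k * c ^+ n * linrec d x y n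
  /\ w n.+1 = k * c ^+ n.+1 * linrec d x y n.+1 by [].
elim: n => [|n [IH0 IH1]]; first by rewrite expr0 expr1 mulr1.
split=> //; rewrite wE IH0 IH1 linrecSS !exprS; ring.
Qed.

(** The coefficients avoid a division by [l2 - l1]; the combination is
    determined by its values at 0 and 1. *)
Lemma linrec_binet (F : fieldType) (d y l1 l2 : F) :
  l1 + l2 = 1 -> l1 * l2 = - d ->
  forall n, (l2 - y) * l1 ^+ n + (y - l1) * l2 ^+ n = (l2 - l1) * linrec d 1 y n.
Proof.
move=> s p n; rewrite -[l2 - l1]mulr1 -[X in _ * X * _](expr1n F n).
apply: (@rescaled_linrec F d (l2 - l1) 1 1 y
  (fun n => (l2 - y) * l1 ^+ n + (y - l1) * l2 ^+ n)) => [||m]; try by ring.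
have -> : d = - (l1 * l2) by rewrite p opprK.
have -> : l2 = 1 - l1 by rewrite -s; ring.
by rewrite !exprS; ring.
Qed.

Lemma linrec_double_root (F : fieldType) (d y : F) : 4 * d = - 1 ->
  forall n, 1 + n%:R * (2 * y - 1) = 2 ^+ n * linrec d 1 y n.
Proof.
move=> d4 n; rewrite -[2 ^+ n]mul1r.
apply: (@rescaled_linrec F d 1 2 1 y
  (fun n => 1 + n%:R * (2 * y - 1))) => [||m]; try by ring.
have -> : 2 ^+ 2 * d = -1 by rewrite -d4; ring.
by ring.
Qed.

Lemma cos_recurrence (R : realType) (t : R) n :
  cos (n.+2%:R * t) = 2 * cos t * cos (n.+1%:R * t) - cos (n%:R * t).
Proof.
have -> : n.+2%:R * t = n.+1%:R * t + t by rewrite -[in LHS]addn1 natrD; ring.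
have -> : n%:R * t = n.+1%:R * t - t by rewrite -[in RHS]addn1 natrD; ring.
by rewrite cosD cosB; ring.
Qed.

Lemma sin_recurrence (R : realType) (t : R) n :
  sin (n.+2%:R * t) = 2 * cos t * sin (n.+1%:R * t) - sin (n%:R * t).
Proof.
have -> : n.+2%:R * t = n.+1%:R * t + t by rewrite -[in LHS]addn1 natrD; ring.
have -> : n%:R * t = n.+1%:R * t - t by rewrite -[in RHS]addn1 natrD; ring.
by rewrite sinD sinB; ring.
Qed.

(** The argument of the roots [(1 +- i sqrt (4 s - 1)) / 2] of [l^2 - l + s],
    which have modulus [sqrt s] and real part [1 / 2]. *)
Definition angle {R : realType} (s : R) : R := acos (1 / (2 * Num.sqrt s)).

Lemma sqrt_gt_half (R : realType) (s : R) : 1 / 4 < s ->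
  1 / 2 < Num.sqrt s.
Proof.
move=> s_gt; have -> : 1 / 2 = Num.sqrt ((1 / 2) ^+ 2) :> R by rewrite sqrtr_sqr ger0_norm.
by rewrite ltr_sqrt ?expr2; lra.
Qed.

Lemma cos_angle (R : realType) (s : R) : 1 / 4 < s ->
  cos (angle s) = 1 / (2 * Num.sqrt s).
Proof.
move=> s_gt; have h := sqrt_gt_half s_gt.
have p : 0 < 2 * Num.sqrt s by lra.
apply: acosK; rewrite in_itv /= ler_pdivlMr // ler_pdivrMr //; lra.
Qed.

Lemma sin_angle (R : realType) (s : R) : 1 / 4 < s ->
  sin (angle s) = Num.sqrt (4 * s - 1) / (2 * Num.sqrt s).
Proof.
move=> s_gt; have h := sqrt_gt_half s_gt.
have p : 0 < 2 * Num.sqrt s by lra.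
rewrite sin_acos; last first.
  by rewrite ler_pdivlMr // ler_pdivrMr //; apply/andP; split; lra.
have s0 : 0 <= s by lra.
have -> : 1 - (1 / (2 * Num.sqrt s)) ^+ 2 = (4 * s - 1) * (1 / (2 * Num.sqrt s)) ^+ 2.
  have := sqr_sqrtr s0 => e.
  have -> : 4 * s = (2 * Num.sqrt s) ^+ 2 by rewrite exprMn e; ring.
  by field; rewrite gt_eqF; lra.
rewrite sqrtrM; last lra.
by rewrite sqrtr_sqr ger0_norm ?divr_ge0 // ?mul1r //; lra.
Qed.

(** The left-hand side is [sqrt s ^- n] times a solution because
    [2 cos (angle s) = 1 / sqrt s] turns the addition formulas into the rescaled
    recurrence; the coefficient [2 y - 1] is the one that gives the value [y] at
    [n = 1]. *)
Lemma linrec_trig (R : realType) (s : R) (y : R[i]) n : 1 / 4 < s ->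
  (Num.sqrt (4 * s - 1))%:C * (cos (n%:R * angle s))%:C
    + (2 * y - 1) * (sin (n%:R * angle s))%:C
  = (Num.sqrt (4 * s - 1))%:C / (Num.sqrt s)%:C ^+ n * linrec (- s%:C) 1 y n.
Proof.
move=> s_gt; have h := sqrt_gt_half s_gt.
have s0 : 0 <= s by lra.
have nz : (Num.sqrt s)%:C != 0 :> R[i] by rewrite fmorph_eq0; lra.
have ct : (cos (angle s))%:C = 1 / (2 * (Num.sqrt s)%:C) :> R[i].
  by rewrite cos_angle // fmorph_div rmorphM rmorph1 rmorph_nat.
rewrite -exprVn.
apply: (@rescaled_linrec _ _ _ _ _ _
  (fun n => (Num.sqrt (4 * s - 1))%:C * (cos (n%:R * angle s))%:C
    + (2 * y - 1) * (sin (n%:R * angle s))%:C)) => [||m].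
- by rewrite mul0r cos0 sin0 rmorph1 rmorph0; ring.
- by rewrite mul1r ct sin_angle // fmorph_div rmorphM rmorph_nat; field.
rewrite cos_recurrence sin_recurrence !rmorphB !rmorphM rmorph_nat /= ct.
rewrite -[in s%:C](sqr_sqrtr s0) rmorphXn.
by field.
Qed.

Lemma characteristic_roots (R : realType) (d : R[i]) :
  let w := sqrtc (1 + 4 * d) in
  let l1 := (1 - w) / 2 in let l2 := (1 + w) / 2 in
  [/\ l1 + l2 = 1, l1 * l2 = - d & l2 - l1 = w].
Proof.
move=> w l1 l2; have w2 : w ^+ 2 = 1 + 4 * d by exact: sqr_sqrtc.
split; [by rewrite /l1 /l2; field | | by rewrite /l1 /l2; field].
have -> : l1 * l2 = (1 - w ^+ 2) / 4 by rewrite /l1 /l2; field.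
by rewrite w2; field.
Qed.

(** * The iteration on its invariant curves and lines *)

Lemma orbitS (R : realType) (B : R[i]) p n : Defs.orbit B p n.+1 = obind (step B) (Defs.orbit B p n).
Proof. by []. Qed.

Lemma forbidden_step_None (R : realType) (B : R[i]) p :
  step B p = None -> forbidden_set B p.
Proof. by move=> h; exists 1%N. Qed.

Lemma forbidden_step_Some (R : realType) (B : R[i]) p q :
  step B p = Some q -> forbidden_set B p <-> forbidden_set B q.
Proof.
move=> pq; have orbitE n : Defs.orbit B p n.+1 = Defs.orbit B q n.
  by rewrite /Defs.orbit iterSr /= pq.
split=> [[[//|n]]|[n]]; first by rewrite orbitE => h; exists n.
by rewrite -orbitE => h; exists n.+1.
Qed.

(** The level set of the conserved quantity
    [(1 / z_n + B) / z_(n-1) = d * B ^+ 2], parametrized by [z_n]. *)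
Definition invariant_curve {R : realType} (B d x : R[i]) : R[i] * R[i] :=
  (x, (B * x + 1) / (d * B ^+ 2 * x)).

Section Dynamics.
Variables (R : realType) (B : R[i]).
Hypothesis B0 : B != 0.

(** The denominator of the step factors as
    [(B x + 1) (d B x - 1) / (d B x)], so on the curve a breakdown can only come
    from the pole of the Moebius map. *)
Lemma step_curve (d x : R[i]) :
  d != 0 -> x != 0 -> B * x + 1 != 0 ->
  step B (invariant_curve B d x) =
  if d * B * x - 1 == 0 then None
  else Some (invariant_curve B d (1 / (B * (d * B * x - 1)))).
Proof.
move=> d0 x0 y0; rewrite /step /=.
have -> : 1 + B * x - B * ((B * x + 1) / (d * B ^+ 2 * x)) =
   (B * x + 1) * (d * B * x - 1) / (d * B * x) by field; rewrite B0 x0 d0.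
rewrite !mulf_eq0 invr_eq0 !mulf_eq0 (negPf y0) (negPf x0) (negPf B0) (negPf d0) !orbF /=.
case: eqP => // /eqP q0; congr (Some (_, _)); field; rewrite ?B0 ?d0 ?x0 ?y0 ?q0 //=.
Qed.

(** Along an orbit [x_k] on the curve, [denom d a n] is the product of the
    [1 - d * B * x_k] with [k < n]: clearing these denominators linearizes the
    Moebius map. *)
Definition denom (d a : R[i]) : nat -> R[i] := linrec d 1 (1 - d * B * a).
Definition curve_point (d a : R[i]) n : R[i] :=
  (1 - denom d a n.+1 / denom d a n) / (d * B).

(** Along the orbit [d B x_n - 1 = - q_(n+1) / q_n], so the test of the step
    number [n + 1] is the nonvanishing of [q_(n+1)]. *)
Lemma curve_orbit (d a : R[i]) n : d != 0 -> a != 0 -> B * a + 1 != 0 ->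
  (forall k, (k <= n)%N -> denom d a k != 0) ->
  [/\ Defs.orbit B (invariant_curve B d a) n = Some (invariant_curve B d (curve_point d a n)),
      curve_point d a n != 0 & B * curve_point d a n + 1 != 0].
Proof.
move=> d0 a0 c0; elim: n => [_|n IH qn].
  have -> : curve_point d a 0 = a by rewrite /curve_point /denom /=; field; rewrite d0 B0.
  by [].
have [|on xn yn] := IH; first by move=> k kn; apply: qn; rewrite ltnW.
rewrite orbitS on /= step_curve //.
have q0 := qn n (leqnSn n); have q1 := qn n.+1 (leqnn _).
have e : d * B * curve_point d a n - 1 = - (denom d a n.+1 / denom d a n).
  by rewrite /curve_point; field; rewrite q0 B0 d0.
have x1 : curve_point d a n.+1 = 1 / (B * (d * B * curve_point d a n - 1)).
  rewrite e /curve_point /denom linrecSS -/(denom _ _ _) -/(denom d a n); field.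
  by rewrite ?q0 ?q1 ?d0 ?B0.
have e0 : d * B * curve_point d a n - 1 != 0.
  by rewrite e oppr_eq0 mulf_neq0 // invr_eq0.
rewrite (negPf e0) x1; split=> //; first by rewrite mul1r invr_eq0 mulf_neq0.
have -> : B * (1 / (B * (d * B * curve_point d a n - 1))) + 1
  = d * B * curve_point d a n / (d * B * curve_point d a n - 1).
  by field; rewrite e0.
by apply: mulf_neq0; [apply: mulf_neq0 => //; apply: mulf_neq0 | rewrite invr_eq0].
Qed.

Lemma forbidden_curve (d a : R[i]) : d != 0 -> a != 0 -> B * a + 1 != 0 ->
  forbidden_set B (invariant_curve B d a) <->
  exists2 n, (0 < n)%N & denom d a n = 0.
Proof.
move=> d0 a0 c0; split=> [[n on]|].
  apply: contrapT => h.
  have [] := @curve_orbit d a n d0 a0 c0; last by rewrite on.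
  move=> [|k] _; first by rewrite oner_eq0.
  by apply/eqP => q0; apply: h; exists k.+1.
move=> [m m0 qm]; have ex : exists m, denom d a m == 0 by exists m; apply/eqP.
(* The first zero matters: up to it the orbit is given by [curve_orbit]. *)
case: (ex_minnP ex) => -[|n] /eqP qn min.
  by move/eqP: qn; rewrite oner_eq0.
have q0 k : (k <= n)%N -> denom d a k != 0.
  by move=> kn; apply/negP => /min; rewrite ltnNge kn.
have [on xn yn] := @curve_orbit d a n d0 a0 c0 q0.
exists n.+1; rewrite orbitS on /= step_curve //.
have -> : d * B * curve_point d a n - 1 = - (denom d a n.+1 / denom d a n).
  by rewrite /curve_point; field; rewrite q0 // d0 B0.
by rewrite qn mul0r oppr0 eqxx.
Qed.

(** Two steps act on the second coordinate by [b |-> b / (1 - B b)], that is, by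
    [1 / b |-> 1 / b - B]. The intermediate step at [(b', 0)] tests [1 + B b'],
    which is a quotient of two consecutive denominators [1 - n B b] and hence
    adds no condition. *)
Lemma axis_orbit (b : R[i]) n :
  (forall k, (k <= n)%N -> 1 - k%:R * B * b != 0) ->
  Defs.orbit B (0, b) (2 * n) = Some (0, b / (1 - n%:R * B * b)).
Proof.
elim: n => [_|n IH qn]; first by rewrite muln0 mul0r mul0r subr0 divr1.
have q0 := qn n (leqnSn n); have q1 := qn n.+1 (leqnn _).
have q1' : 1 - (1 + n%:R) * B * b != 0 by rewrite nat1r.
rewrite mulnS orbitS orbitS IH /=; last by move=> k kn; apply: qn; rewrite ltnW.
rewrite /step /= mulr0 addr0.
have -> : 1 - B * (b / (1 - n%:R * B * b)) = (1 - n.+1%:R * B * b) / (1 - n%:R * B * b).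
  by rewrite -nat1r; field; rewrite q0.
rewrite mulf_eq0 invr_eq0 (negPf q0) (negPf q1) /= mulr0 subr0 mul0r.
have -> : b / (1 - n%:R * B * b) / ((1 - n.+1%:R * B * b) / (1 - n%:R * B * b))
   = b / (1 - n.+1%:R * B * b).
  by rewrite -nat1r; field; rewrite q0 q1'.
have -> : 1 + B * (b / (1 - n.+1%:R * B * b)) = (1 - n%:R * B * b) / (1 - n.+1%:R * B * b).
  by rewrite -nat1r; field; rewrite q1'.
by rewrite mulf_eq0 invr_eq0 (negPf q0) (negPf q1).
Qed.

Lemma forbidden_axis (b : R[i]) :
  forbidden_set B (0, b) <-> exists2 n, (0 < n)%N & n%:R * B * b = 1.
Proof.
split=> [[n on]|].
  apply: contrapT => h.
  suff : Defs.orbit B (0, b) (2 * n) = None by rewrite axis_orbit // => -[|k] _;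
    rewrite ?mul0r ?subr0 ?oner_eq0 // subr_eq0; apply/eqP=> e; apply: h; exists k.+1.
  (* A breakdown persists, so it is still there at the even time [2 n]. *)
  rewrite mul2n -addnn; elim: {2}n => [|m IH]; first by rewrite addn0.
  by rewrite addnS orbitS IH.
move=> [m m0 qm].
have ex : exists m, 1 - m%:R * B * b == 0 by exists m; rewrite qm subrr.
case: (ex_minnP ex) => -[|n]; first by rewrite !mul0r subr0 oner_eq0.
move=> /eqP qn min.
have q0 k : (k <= n)%N -> 1 - k%:R * B * b != 0.
  by move=> kn; apply/negP => /min; rewrite ltnNge kn.
exists (2 * n).+1; rewrite orbitS axis_orbit //= /step /= mulr0 addr0.
have -> : 1 - B * (b / (1 - n%:R * B * b)) = (1 - n.+1%:R * B * b) / (1 - n%:R * B * b).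
  by rewrite -nat1r; field; rewrite q0.
by rewrite qn mul0r eqxx.
Qed.

Lemma step_axis (a : R[i]) :
  step B (a, 0) = if 1 + B * a == 0 then None else Some (0, a).
Proof. by rewrite /step /= mulr0 subr0 mul0r. Qed.

(** The numerator [z_(-1)] cancels: when [z_0 = - 1 / B] the denominator is
    [- B z_(-1)]. *)
Lemma step_fixed_line (b : R[i]) : b != 0 ->
  step B (- 1 / B, b) = Some (- 1 / B, - 1 / B).
Proof.
move=> b0; rewrite /step /=.
have -> : 1 + B * (- 1 / B) - B * b = - (B * b) by field.
rewrite oppr_eq0 mulf_eq0 (negPf B0) (negPf b0) /=; congr (Some (_, _)).
by field; rewrite b0 B0.
Qed.

Lemma fixed_line_orbit (b : R[i]) n : b != 0 ->
  Defs.orbit B (- 1 / B, b) n.+1 = Some (- 1 / B, - 1 / B).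
Proof.
move=> b0; elim: n => [|n IH]; first exact: step_fixed_line.
rewrite orbitS IH /= step_fixed_line //.
by rewrite mulf_neq0 ?invr_eq0 // oppr_eq0 oner_eq0.
Qed.

Lemma fixed_line_not_forbidden (b : R[i]) : b != 0 ->
  ~ forbidden_set B (- 1 / B, b).
Proof. by move=> b0 [[|n]] //; rewrite fixed_line_orbit. Qed.

Lemma fixed_line_start_forbidden : forbidden_set B (- 1 / B, 0).
Proof.
apply: forbidden_step_None; rewrite step_axis.
have -> : 1 + B * (- 1 / B) = 0 by field.
by rewrite eqxx.
Qed.

Lemma curve_parameter_neq0 (a b : R[i]) : a != 0 -> b != 0 -> B * a + 1 != 0 ->
  (1 / a + B) * (1 / b) / B ^+ 2 != 0.
Proof.
move=> a0 b0 c0.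
rewrite !mulf_neq0 ?invr_eq0 ?oner_eq0 ?expf_neq0 //.
have -> : 1 / a + B = (B * a + 1) / a by field.
by rewrite mulf_neq0 ?invr_eq0.
Qed.

Lemma on_invariant_curve (a b : R[i]) : a != 0 -> b != 0 -> B * a + 1 != 0 ->
  (a, b) = invariant_curve B ((1 / a + B) * (1 / b) / B ^+ 2) a.
Proof.
move=> a0 b0 c0; congr (_, _); field; rewrite a0 b0 B0 /=.
by rewrite addrC.
Qed.
End Dynamics.

(** * Zeros of the recurrence in closed form *)

Lemma sin_eq0 (R : realType) (x : R) :
  sin x = 0 <-> exists k : int, x = k%:~R * pi.
Proof.
have sin_nat (y : R) (n : nat) : `|sin (y + n%:R * pi)| = `|sin y|.
  elim: n => [|n IH]; first by rewrite mul0r addr0.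
  by rewrite -natr1 mulrDl mul1r addrA sinDpi normrN.
have sin_int (y : R) (k : int) : `|sin (y + k%:~R * pi)| = `|sin y|.
  case: k => n; first exact: sin_nat.
  by rewrite -(sin_nat (y + _) n.+1) NegzE mulrNz mulNr subrK.
split=> [sx|[k ->]]; last first.
  by apply/normr0_eq0; rewrite -[X in sin X]add0r sin_int sin0 normr0.
have p0 := pi_gt0 R.
(* The integer part moves [x] into [[0, pi)], where only 0 is a zero. *)
exists (Num.floor (x / pi)); set k := Num.floor _.
have /andP[kx xk] := floor_itv (x / pi).
have kx' : k%:~R * pi <= x by rewrite -ler_pdivlMr.
have xk' : x < (k + 1)%:~R * pi by rewrite -ltr_pdivrMr.
apply/eqP; rewrite eq_le kx' andbT leNgt; apply/negP => lt.
have /gt_eqF/negP[] : 0 < sin (x - k%:~R * pi).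
  by apply: sin_gt0_pi; rewrite subr_gt0 lt /= ltrBlDr; move: xk'; rewrite intrD; lra.
by rewrite -normr_eq0 -mulNr -mulrNz sin_int sx normr0.
Qed.

Lemma Re_eq0_of_norm (R : realType) (w : R[i]) : `|1 + w| = `|1 - w| ->
  complex.Re w = 0.
Proof.
case: w => p q; rewrite !normc_def /= => -[/eqP].
rewrite eqr_sqrt ?addr_ge0 ?sqr_ge0 // => /eqP e; lra.
Qed.

(** Equality of the powers would force [1 + w] and [1 - w] to have the same
    modulus, hence [w] to be purely imaginary and its square [1 + 4 d] to be a
    nonpositive real. *)
Lemma sqrtc_powers_neq (R : realType) (d : R[i]) n :
  ~ real_interval `]-oo, (- (1 / 4))] d -> (0 < n)%N ->
  (1 + sqrtc (1 + 4 * d)) ^+ n - (1 - sqrtc (1 + 4 * d)) ^+ n != 0.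
Proof.
move=> dP n0; apply/negP => /eqP/subr0_eq e; apply: dP.
have := sqr_sqrtc (1 + 4 * d); set w := sqrtc _ in e *.
have : complex.Re w = 0.
  apply: Re_eq0_of_norm; have := congr1 Num.norm e; rewrite !normrX.
  by move/eqP; rewrite eqrXn2 // => /eqP.
case: w e => p q /= _ -> w2; exists (- (1 + q ^+ 2) / 4).
  by rewrite /= in_itv /=; have := sqr_ge0 q; lra.
have -> : d = (- 1 + (0 +i* q) ^+ 2) / 4 by rewrite w2; field.
rewrite (_ : (0 +i* q) ^+ 2 = - (q ^+ 2)%:C).
  by rewrite rmorphM fmorphV rmorphN rmorphD !rmorph_nat rmorph1 /=; ring.
by rewrite expr2; apply/eqP; simpc.
Qed.

(** For fixed [d] and [n] the number [denom B d a n] is affine in [a], since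
    [a] only enters through the second initial value. Solving
    [denom B d a n = 0] in the form given by [linrec_binet] yields the element
    of index [n] of [P]; its denominator is nonzero by [sqrtc_powers_neq], and
    its factor 2 comes from writing the roots as [(1 +- w) / 2]. *)
Lemma mem_P (R : realType) (B d a : R[i]) : B != 0 -> d != 0 ->
  ~ real_interval `]-oo, (- (1 / 4))] d ->
  P B d a <-> exists2 n, (0 < n)%N & denom B d a n = 0.
Proof.
move=> B0 d0 dP.
have := @sqrtc_powers_neq R d ^~ dP.
have := characteristic_roots d; rewrite /P; set w := sqrtc _.
set l1 := (1 - w) / 2; set l2 := (1 + w) / 2 => -[s m dw] pw.
have w0 : l2 - l1 != 0.
  have -> : l2 - l1 = ((1 + w) ^+ 1 - (1 - w) ^+ 1) / 2 by rewrite dw; field.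
  by rewrite mulf_neq0 ?invr_eq0 ?pnatr_eq0 // pw.
have e1 : 1 - w = 2 * l1 by rewrite /l1; field.
have e2 : 1 + w = 2 * l2 by rewrite /l2; field.
(* From here on [l1] and [l2] matter only through the relations above. *)
clearbody l1 l2.
have E n : denom B d a n.+1 = 0 <->
   2 / B * (((1 + w) ^+ n - (1 - w) ^+ n) / ((1 + w) ^+ n.+1 - (1 - w) ^+ n.+1))
     + 1 / (d * B) = a.
  have := pw n.+1 isT.
  have -> : denom B d a n.+1 = 0 <->
    (l2 - (1 - d * B * a)) * l1 ^+ n.+1 + ((1 - d * B * a) - l1) * l2 ^+ n.+1 = 0.
    rewrite (linrec_binet _ s m) -/(denom B d a n.+1); split=> [-> | /eqP]; first by rewrite mulr0.
    by rewrite mulf_eq0 (negPf w0) => /eqP.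
  rewrite e1 e2 !exprMn -!mulrBr mulf_eq0 negb_or => /andP[t0 D0].
  have n2 : 2 ^+ n != 0 :> R[i] by rewrite expf_neq0 // pnatr_eq0.
  have -> : (l2 - (1 - d * B * a)) * l1 ^+ n.+1 + ((1 - d * B * a) - l1) * l2 ^+ n.+1
      = (1 - d * B * a) * (l2 ^+ n.+1 - l1 ^+ n.+1) + d * (l2 ^+ n - l1 ^+ n).
    have -> : d * (l2 ^+ n - l1 ^+ n) = - (l1 * l2) * (l2 ^+ n - l1 ^+ n).
      by rewrite m opprK.
    by rewrite !exprS; ring.
  set D := l2 ^+ n.+1 - l1 ^+ n.+1 in D0 *; rewrite exprS.
  have E : 2 / B * (2 ^+ n * (l2 ^+ n - l1 ^+ n) / (2 * 2 ^+ n * D)) + 1 / (d * B) - a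
      = ((1 - d * B * a) * D + d * (l2 ^+ n - l1 ^+ n)) / (d * B * D).
    by field; rewrite n2 D0 B0 d0.
  split=> [N | /eqP]; first by apply/eqP; rewrite -subr_eq0 E N mul0r.
  rewrite -subr_eq0 E mulf_eq0 invr_eq0 !mulf_eq0 (negPf d0) (negPf B0) (negPf D0) !orbF.
  by move/eqP.
split=> [[[//|n] _ e] | [[//|n] _ e]]; exists n.+1 => //; move: e; rewrite subn1; apply E.
Qed.

(** A zero of the trigonometric form forces a nonzero sine, because the cosine
    has the nonzero coefficient [sqrt (- 4 d - 1)]; dividing by the sine makes
    the cotangent appear. *)
Lemma mem_Q (R : realType) (B a : R[i]) (d : R) : B != 0 -> d < - (1 / 4) ->
  Q B d a <-> exists2 n, (0 < n)%N & denom B d%:C a n = 0.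
Proof.
move=> B0 dlt; have s_gt : 1 / 4 < - d by lra.
have d0 : d%:C != 0 :> R[i] by rewrite fmorph_eq0; lra.
have s0 := sqrt_gt_half s_gt.
have E0 : (Num.sqrt (4 * - d - 1))%:C != 0 :> R[i].
  by rewrite fmorph_eq0 sqrtr_eq0 -ltNge; lra.
have S0 : (Num.sqrt (- d))%:C != 0 :> R[i] by rewrite fmorph_eq0; lra.
have Z n : denom B d%:C a n = 0 <->
  (Num.sqrt (4 * - d - 1))%:C * (cos (n%:R * angle (- d)))%:C
    + (1 - 2 * d%:C * B * a) * (sin (n%:R * angle (- d)))%:C = 0.
  have := linrec_trig (1 - d%:C * B * a) n s_gt; rewrite rmorphN opprK -/(denom B d%:C a n).
  have -> : 2 * (1 - d%:C * B * a) - 1 = 1 - 2 * d%:C * B * a by ring.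
  move=> ->; split=> [-> | /eqP]; first by rewrite mulr0.
  by rewrite !mulf_eq0 invr_eq0 expf_eq0 (negPf E0) (negPf S0) andbF => /eqP.
move: E0 Z; rewrite /Q -/(angle (- d)).
have -> : 4 * - d - 1 = -4 * d - 1 by ring.
set E := Num.sqrt _ => E0 Z.
have H n : sin (n%:R * angle (- d)) != 0 ->
   denom B d%:C a n = 0 <->
   - 1 / (2 * d%:C * B) * (- 1 - E%:C * (cot (n%:R * angle (- d)))%:C) = a.
  rewrite -(fmorph_eq0 (real_complex R)) => sn; rewrite Z /cot fmorph_div /=.
  split=> [e|<-]; last by field; rewrite sn d0 B0.
  apply/eqP; rewrite -subr_eq0.
  have -> : - 1 / (2 * d%:C * B) * (- 1 - E%:C * ((cos (n%:R * angle (- d)))%:C / (sin (n%:R * angle (- d)))%:C)) - a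
    = (E%:C * (cos (n%:R * angle (- d)))%:C + (1 - 2 * d%:C * B * a) * (sin (n%:R * angle (- d)))%:C)
     / (2 * d%:C * B * (sin (n%:R * angle (- d)))%:C) by field; rewrite sn d0 B0.
  by rewrite e mul0r.
split=> [[n [n0 /sin_eq0/eqP sn] e] | [n n0 e]].
  by exists n => //; apply/H.
have sn : sin (n%:R * angle (- d)) != 0.
  apply/eqP => s1; have := e; rewrite Z s1 rmorph0 mulr0 addr0 => /eqP.
  rewrite mulf_eq0 (negPf E0) fmorph_eq0 /= => /eqP c1.
  by have := sin0cos1 s1; rewrite c1 normr0 => /eqP; rewrite eq_sym oner_eq0.
exists n; last exact/H.
by split=> // /sin_eq0/eqP; apply/negP.
Qed.

Lemma mem_double_root (R : realType) (B a : R[i]) : B != 0 ->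
  [set (- 2 * n%:R - 2) / (B * n%:R) | n in positive_nat] a <->
  exists2 n, (0 < n)%N & denom B (- (1 / 4)) a n = 0.
Proof.
move=> B0.
have h n : (0 < n)%N ->
    denom B (- (1 / 4)) a n = 0 <-> (- 2 * n%:R - 2) / (B * n%:R) = a.
  move=> n0; have nz : n%:R != 0 :> R[i] by rewrite pnatr_eq0 -lt0n.
  have d4 : 4 * - (1 / 4) = -1 :> R[i] by field.
  have z : denom B (- (1 / 4)) a n = 0 <-> 1 + n%:R * (1 + B * a / 2) = 0.
    have := linrec_double_root (1 - - (1 / 4) * B * a) d4 n; rewrite -/(denom B (- (1 / 4)) a n).
    have -> : 2 * (1 - - (1 / 4) * B * a) - 1 = 1 + B * a / 2 by field.
    move=> ->; split=> [-> | /eqP]; first by rewrite mulr0.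
    by rewrite mulf_eq0 expf_eq0 pnatr_eq0 andbF => /eqP.
  rewrite z; split=> [e | <-]; last by field; rewrite nz B0.
  apply/eqP; rewrite -subr_eq0.
  have -> : (- 2 * n%:R - 2) / (B * n%:R) - a =
    - 2 * (1 + n%:R * (1 + B * a / 2)) / (B * n%:R) by field; rewrite nz B0.
  by rewrite e mulr0 mul0r.
split=> [[n n0 /h e] | [n n0 /h e]]; first by exists n => //; apply: e.
by exists n => //; apply: e.
Qed.

(** * The forbidden set *)

Lemma real_complexNquarter (R : realType) : (- (1 / 4))%:C = - (1 / 4) :> R[i].
Proof. by rewrite rmorphN fmorph_div rmorph1 rmorph_nat. Qed.

Lemma neq_fixed_point (R : realType) (B a : R[i]) : B != 0 ->
  (B * a + 1 != 0) = (a != - 1 / B).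
Proof.
move=> B0; congr (~~ _); rewrite -[a == _]subr_eq0.
have -> : a - - 1 / B = (B * a + 1) / B by field.
by rewrite mulf_eq0 invr_eq0 (negPf B0) orbF.
Qed.

Lemma on_axis (R : realType) (B b : R[i]) n : B != 0 -> (0 < n)%N ->
  n%:R * B * b = 1 <-> b = 1 / (B * n%:R).
Proof.
move=> B0 n0; have nz : n%:R != 0 :> R[i] by rewrite pnatr_eq0 -lt0n.
split=> [e|->]; last by field; rewrite nz B0.
have -> : b = n%:R * B * b / (B * n%:R) by field; rewrite nz B0.
by rewrite e.
Qed.

Lemma forbidden_set_sub (R : realType) (B : R[i]) : B != 0 ->
  forbidden_set B `<=` S2 B.
Proof.
move=> B0 [a b] F.
have [a0|a0] := eqVneq a 0.
  move: F; rewrite a0 => /forbidden_axis[n n0 /(on_axis _ B0 n0) ->].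
  by do 4! left; right; exists n.
have [b0|b0] := eqVneq b 0.
  have := step_axis B a; rewrite -b0; case: eqP => [e _|_ st].
    do 5! left; rewrite /= b0; congr (_, _); apply/eqP.
    by apply: contraT; rewrite -(neq_fixed_point _ B0) addrC e b0 eqxx.
  move: F => /(forbidden_step_Some st); rewrite b0 => /forbidden_axis[n n0].
  by move=> /(on_axis _ B0 n0) ->; do 3! left; right; exists n.
have c0 : B * a + 1 != 0.
  rewrite (neq_fixed_point _ B0); apply/eqP => e; move: F; rewrite e.
  exact: fixed_line_not_forbidden.
have notin : ~ [set 0; - 1 / B] a.
  by move=> [|] /eqP; [rewrite (negPf a0) | rewrite -[_ == _]negbK -neq_fixed_point // c0].
move: F; rewrite (on_invariant_curve B0 a0 b0 c0).
set d := _ / B ^+ 2 => F.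
have d0 : d != 0 by exact: curve_parameter_neq0.
move: F => /(forbidden_curve B0 d0 a0 c0) F.
(* The discriminant [1 + 4 d] is off the closed negative half-line, zero, or
   negative. *)
have [[t] /= tI td|dP] := pselect (real_interval `]-oo, (- (1 / 4))] d); last first.
  left; left; right; exists d; first by move=> -[//|/eqP]; rewrite (negPf d0).
  by exists a => //; split=> //; apply/mem_P.
move: tI; rewrite in_itv /= le_eqVlt => /orP[/eqP t4|tlt].
  right; exists a.
    by split=> //; apply/mem_double_root => //; rewrite -real_complexNquarter -t4 td.
  rewrite -td t4 real_complexNquarter; congr (_, _).
  by field; rewrite B0 a0.
left; right; exists t; first by rewrite /= in_itv.
exists a; last by rewrite -td.
by split=> //; apply/mem_Q; rewrite // td.
Qed.

Lemma sub_forbidden_set (R : realType) (B : R[i]) : B != 0 ->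
  S2 B `<=` forbidden_set B.
Proof.
move=> B0.
have curve d a : d != 0 -> ~ [set 0; - 1 / B] a ->
    (exists2 n, (0 < n)%N & denom B d a n = 0) ->
    forbidden_set B (a, (B * a + 1) / (d * B ^+ 2 * a)).
  move=> d0 na q; apply/(forbidden_curve B0) => //.
    by apply/eqP => a0; apply: na; left.
  by rewrite neq_fixed_point //; apply/eqP => a0; apply: na; right.
move=> p [[[[[/= ->|[n n0 <-]]|[n n0 <-]]|]|]|].
- exact: fixed_line_start_forbidden.
- by apply/forbidden_axis => //; exists n => //; apply/on_axis.
- have nz : n%:R != 0 :> R[i] by rewrite pnatr_eq0 -lt0n.
  have st : step B (1 / (B * n%:R), 0) = Some (0, 1 / (B * n%:R)).
    rewrite step_axis; have -> : 1 + B * (1 / (B * n%:R)) = n.+1%:R / n%:R.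
      by rewrite -nat1r; field; rewrite nz B0.
    by rewrite mulf_eq0 invr_eq0 (negPf nz) pnatr_eq0.
  apply/(forbidden_step_Some st)/forbidden_axis => //.
  by exists n => //; apply/on_axis.
- move=> [d dP [a [Pa na] <-]].
  have d0 : d != 0 by apply/eqP => d0; apply: dP; right.
  apply: curve => //; apply/(mem_P _ _ _ _).1 => //.
  by move=> dI; apply: dP; left.
- move=> [d]; rewrite /= in_itv /= => dlt [a [Qa na] <-].
  apply: curve => //; first by rewrite fmorph_eq0; lra.
  exact/(mem_Q _ B0 dlt).
- move=> [a [Da na] <-].
  have a0 : a != 0 by apply/eqP => a0; apply: na; left.
  have -> : (- 4 * B * a - 4) / (B ^+ 2 * a) =
     (B * a + 1) / (- (1 / 4) * B ^+ 2 * a) by field; rewrite B0 a0.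
  apply: curve => //; exact/(mem_double_root _ B0).
Qed.

(** * Solutions *)

(** Off the forbidden set, the total division of a solution is never a division
    by zero, so the solution is the orbit. *)
Lemma solution_orbit (R : realType) (B : R[i]) (z : int -> R[i]) (n : nat) :
  is_solution B z -> ~ forbidden_set B (z 0, z (-1)) ->
  Defs.orbit B (z 0, z (-1)) n = Some (z n%:Z, z (n%:Z - 1)).
Proof.
move=> zs nf; elim: n => [//|n IH].
have [e|] := eqVneq (Defs.orbit B (z 0, z (-1)) n.+1) None.
  by case: nf; exists n.+1.
rewrite orbitS IH /= /step /=; case: ifP => // _ _.
by rewrite -zs -addn1 PoszD addrK.
Qed.

Lemma axis_solution (R : realType) (B : R[i]) (z : int -> R[i]) :
  B != 0 -> is_solution B z -> ~ forbidden_set B (z 0, z (-1)) ->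
  z 0 = 0 -> forall n : nat,
  [/\ 1 - n%:R * B * z (-1) != 0, z (2 * n%:Z) = 0
    & z (2 * n%:Z - 1) = z (-1) / (1 - n%:R * B * z (-1))].
Proof.
move=> B0 zs nf z0 n.
have q k : 1 - k%:R * B * z (-1) != 0.
  case: k => [|k]; first by rewrite !mul0r subr0 oner_eq0.
  apply/eqP => /subr0_eq/esym e; apply: nf; rewrite z0.
  by apply/forbidden_axis => //; exists k.+1.
have := solution_orbit (2 * n)%N zs nf.
by rewrite [in LHS]z0 axis_orbit // PoszM => -[<- <-].
Qed.

Lemma curve_solution (R : realType) (B : R[i]) (z : int -> R[i]) :
  B != 0 -> is_solution B z -> ~ forbidden_set B (z 0, z (-1)) ->
  z 0 != 0 -> B * z 0 + 1 != 0 -> z (-1) != 0 ->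
  let d := (1 / z 0 + B) * (1 / z (-1)) / B ^+ 2 in
  d != 0 /\ forall n : nat, denom B d (z 0) n != 0 /\
    z n%:Z = (1 - denom B d (z 0) n.+1 / denom B d (z 0) n) / (d * B).
Proof.
move=> B0 zs nf z0 c0 z1 d.
have d0 : d != 0 by exact: curve_parameter_neq0.
have e := on_invariant_curve B0 z0 z1 c0; rewrite -/d in e.
have q k : denom B d (z 0) k != 0.
  case: k => [|k]; first by rewrite oner_eq0.
  apply/eqP => qk; apply: nf; rewrite e; apply/forbidden_curve => //.
  by exists k.+1.
split=> // n; split=> //.
have [] := @curve_orbit _ _ B0 d (z 0) n d0 z0 c0 => // + _ _.
by rewrite -e solution_orbit // => -[->].
Qed.

Lemma axis_closed_form (R : realType) (B : R[i]) (z : int -> R[i]) :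
  B != 0 -> is_solution B z -> ~ forbidden_set B (z 0, z (-1)) ->
  z 0 = 0 ->
      [/\ forall n : nat, z (2 * n%:Z) = 0,
          forall n : nat, 1 - B * z (2 * n%:Z - 1) != 0 /\
            z (2 * n%:Z + 1) = z (2 * n%:Z - 1) / (1 - B * z (2 * n%:Z - 1))
        & forall n : int, -1 <= n ->
            1 - (n + 1)%:~R * B * z (-1) != 0 /\
            z (2 * n + 1) =
              1 / - B * ((1 - (n + 2)%:~R * B * z (-1))
                         / (1 - (n + 1)%:~R * B * z (-1))) + 1 / B].
Proof.
move=> B0 zs nf z0; have A := axis_solution B0 zs nf z0.
have odd n : 2 * n%:Z + 1 = 2 * (n.+1)%:Z - 1 :> int by lia.
split=> n.
- by case: (A n).
- have [q _ zn] := A n; have [q1 _ zn1] := A n.+1.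
  rewrite odd zn zn1.
  have -> : 1 - B * (z (-1) / (1 - n%:R * B * z (-1)))
     = (1 - n.+1%:R * B * z (-1)) / (1 - n%:R * B * z (-1)).
    by rewrite -nat1r; field.
  split; first by rewrite mulf_neq0 ?invr_eq0.
  rewrite -nat1r in q1 *; field.
  by rewrite q q1.
move=> n1; have [m nm] : exists m : nat, n = m%:Z - 1.
  by exists (absz (n + 1)); lia.
have [q _ zm] := A m.
have -> : 2 * n + 1 = 2 * m%:Z - 1 by lia.
have -> : n + 2 = m.+1 by lia.
have -> : n + 1 = m by lia.
split=> //; rewrite zm -!pmulrn -nat1r; field.
by rewrite q B0.
Qed.

Section ClosedForms.
Variables (R : realType) (B C d a : R[i]).
Hypotheses (B0 : B != 0) (d0 : d != 0) (CE : C = d * B ^+ 2).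
Local Notation q := (denom B d a).

Lemma quotient_form (r : R[i]) : (1 - r) / (d * B) = - B / C * r + B / C.
Proof. by rewrite CE; field; rewrite d0 B0. Qed.

(** The three closed forms exhibit numerators and denominators proportional to
    consecutive terms of [q]; only their quotient and the nonvanishing matter. *)
Lemma closed_form_of_multiple (k k' num den : R[i]) n : k != 0 -> q n != 0 ->
  num = k * k' * q n.+1 -> den = k * q n ->
  den != 0 /\ num / den = k' * (q n.+1 / q n).
Proof.
by move=> k0 qn -> ->; split; [rewrite mulf_neq0 | field; rewrite k0 qn].
Qed.

Lemma quotient_distinct_roots n : ~ real_interval `[1 / 4, +oo[ (- C / B ^+ 2) -> q n != 0 ->
  let l1 := (1 - sqrtc (1 + 4 * C / B ^+ 2)) / 2 in
  let l2 := (1 + sqrtc (1 + 4 * C / B ^+ 2)) / 2 in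
  let num := (B * l2 + C * a - B) * l1 ^+ n.+1 + (B - C * a - B * l1) * l2 ^+ n.+1 in
  let den := (B * l2 + C * a - B) * l1 ^+ n + (B - C * a - B * l1) * l2 ^+ n in
  den != 0 /\ num / den = q n.+1 / q n.
Proof.
have -> : - C / B ^+ 2 = - d by rewrite CE; field.
have -> : 1 + 4 * C / B ^+ 2 = 1 + 4 * d by rewrite CE; field.
move=> dI qn.
have w0 : sqrtc (1 + 4 * d) != 0.
  rewrite sqrtc_eq0; apply/eqP => e; apply: dI; exists (1 / 4).
    by rewrite /= in_itv /= lexx.
  rewrite fmorph_div rmorph1 rmorph_nat.
  have -> : - d = (1 - (1 + 4 * d)) / 4 by field.
  by rewrite e subr0.
have [s m dw] := characteristic_roots d.
move: w0 s m dw; set w := sqrtc _ => w0 s m dw l1 l2.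
rewrite -/l1 -/l2 in s m dw.
have binet k : (B * l2 + C * a - B) * l1 ^+ k + (B - C * a - B * l1) * l2 ^+ k
    = B * w * q k.
  have := linrec_binet (1 - d * B * a) s m k; rewrite -/(q k) dw => e.
  by rewrite -mulrA -e CE; ring.
move=> num den; rewrite -[_ / q n]mul1r; apply: (@closed_form_of_multiple (B * w)) => //.
- by rewrite mulf_neq0.
- by rewrite mulr1 -binet.
- by rewrite -binet.
Qed.

Lemma quotient_double_root n : - C / B ^+ 2 = 1 / 4 -> q n != 0 ->
  let num := - B + (n%:R + 1) * (2 * C * a - B) in
  let den := - 2 * B + 4 * n%:R * C * a - 2 * n%:R * B in
  den != 0 /\ num / den = q n.+1 / q n.
Proof.
have -> : - C / B ^+ 2 = - d by rewrite CE; field.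
move=> d4 qn num den.
have {}d4 : 4 * d = - 1.
  have -> : 4 * d = - 4 * (- d) by ring.
  by rewrite d4; field.
have E k : q k = (1 + k%:R * (2 * (1 - d * B * a) - 1)) / 2 ^+ k.
  rewrite (linrec_double_root _ d4) -/(q k) [2 ^+ k * _]mulrC mulfK // expf_neq0 ?pnatr_eq0.
rewrite -[_ / q n]mul1r; apply: (@closed_form_of_multiple (- 2 * B * 2 ^+ n)) => //.
- by rewrite !mulf_neq0 ?expf_neq0 ?oppr_eq0 ?pnatr_eq0.
- rewrite E /num CE -nat1r (exprS 2); field.
  by rewrite expf_neq0 ?pnatr_eq0.
- rewrite E /den CE; field.
  by rewrite expf_neq0 ?pnatr_eq0.
Qed.

Lemma sqrtc_real (x : R) : 0 <= x -> sqrtc x%:C = (Num.sqrt x)%:C :> R[i].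
Proof. by move=> x0; rewrite sqrtc_sqrtr // ler0c. Qed.

Lemma quotient_conjugate_roots n : real_interval `]1 / 4, +oo[ (- C / B ^+ 2) -> q n != 0 ->
  let D := B * sqrtc (- 4 * C / B ^+ 2 - 1) in
  let rho := acos (complex.Re (sqrtc (- B ^+ 2 / (4 * C)))) in
  let num := D * (cos (n.+1%:R * rho))%:C
             + (B - 2 * C * a) * (sin (n.+1%:R * rho))%:C in
  let den := B * D * (cos (n%:R * rho))%:C
             + (B ^+ 2 - 2 * C * B * a) * (sin (n%:R * rho))%:C in
  den != 0 /\
  sqrtc (- B ^+ 2 / C) * (num / den) = - B / C * (q n.+1 / q n).
Proof.
have -> : - C / B ^+ 2 = - d by rewrite CE; field.
move=> [s]; rewrite /= in_itv /= andbT => s4 sd qn.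
have {sd} dE : d = - s%:C by rewrite sd opprK.
have sq := sqrt_gt_half s4.
have s0 : s%:C != 0 :> R[i] by rewrite fmorph_eq0; lra.
have S0 : (Num.sqrt s)%:C != 0 :> R[i] by rewrite fmorph_eq0; lra.
have S2 : (Num.sqrt s)%:C ^+ 2 = s%:C :> R[i].
  by rewrite -rmorphXn /= sqr_sqrtr //; lra.
have -> : - 4 * C / B ^+ 2 - 1 = (4 * s - 1)%:C.
  by rewrite CE dE rmorphB rmorphM rmorph1 rmorph_nat /=; field.
have -> : - B ^+ 2 / (4 * C) = (1 / (4 * s))%:C.
  by rewrite CE dE fmorph_div rmorphM rmorph1 rmorph_nat /=; field; rewrite s0 B0.
have -> : - B ^+ 2 / C = (1 / s)%:C.
  by rewrite CE dE fmorph_div rmorph1 /=; field; rewrite s0 B0.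
have p1 : 0 <= 4 * s - 1 by lra.
have p2 : 0 <= 1 / s by rewrite divr_ge0 //; lra.
have p3 : 0 <= 1 / (4 * s) by rewrite divr_ge0 //; lra.
rewrite !sqrtc_real //.
have -> : Num.sqrt (1 / s) = 1 / Num.sqrt s by rewrite !mul1r sqrtrV //; lra.
have -> : Num.sqrt (1 / (4 * s)) = 1 / (2 * Num.sqrt s).
  have -> : 4 * s = 2 ^+ 2 * s by ring.
  rewrite !mul1r sqrtrV; last by rewrite expr2; lra.
  by rewrite sqrtrM ?sqr_ge0 // sqrtr_sqr ger0_norm.
rewrite /= -/(angle s); set t := angle s; set e := Num.sqrt (4 * s - 1).
have e0 : e%:C != 0 :> R[i] by rewrite fmorph_eq0 sqrtr_eq0 -ltNge; lra.
have trig k : e%:C * (cos (k%:R * t))%:C + (1 - 2 * d * B * a) * (sin (k%:R * t))%:C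
    = e%:C / (Num.sqrt s)%:C ^+ k * q k.
  rewrite /q dE -linrec_trig //; congr (_ + _ * _); ring.
(* The left factors differ by [1 / (B sqrt s)], which the prefactor
   [1 / sqrt s] completes to [1 / (B s) = - B / C]. *)
have [||||den0 ->] := @closed_form_of_multiple (B ^+ 2 * e%:C / (Num.sqrt s)%:C ^+ n)
  (1 / (B * (Num.sqrt s)%:C))
  (B * e%:C * (cos (n.+1%:R * t))%:C + (B - 2 * C * a) * (sin (n.+1%:R * t))%:C)
  (B * (B * e%:C) * (cos (n%:R * t))%:C + (B ^+ 2 - 2 * C * B * a) * (sin (n%:R * t))%:C) n.
- by rewrite !mulf_neq0 ?invr_eq0 ?expf_neq0.
- by [].
- have -> : B ^+ 2 * e%:C / (Num.sqrt s)%:C ^+ n * (1 / (B * (Num.sqrt s)%:C)) * q n.+1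
    = B * (e%:C / (Num.sqrt s)%:C ^+ n.+1 * q n.+1).
    by rewrite (exprS (Num.sqrt s)%:C); field; rewrite ?expf_neq0 // S0 B0.
  by rewrite -trig CE; ring.
- have -> : B ^+ 2 * e%:C / (Num.sqrt s)%:C ^+ n * q n
    = B ^+ 2 * (e%:C / (Num.sqrt s)%:C ^+ n * q n) by ring.
  by rewrite -trig CE; ring.
split=> //; rewrite [LHS]mulrA; congr (_ * _).
rewrite fmorph_div rmorph1 /= CE dE -S2; field.
by rewrite S0 B0.
Qed.
End ClosedForms.

Unset Implicit Arguments.

Theorem theorem3 (R : realType) (B : R[i]) (hB : B != 0) :
  forbidden_set B = S2 B /\
  forall z : int -> R[i], is_solution B z ->
  ~ forbidden_set B (z 0, z (-1)) ->
  [/\ [\/ z 0 = 0, z (-1) = 0, z 0 = - 1 / B |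
          [/\ z 0 != 0, z 0 != - 1 / B & z (-1) != 0]],
      (* (i) *)
      z 0 = 0 ->
      [/\ forall n : nat, z (2 * n%:Z) = 0,
          forall n : nat, 1 - B * z (2 * n%:Z - 1) != 0 /\
            z (2 * n%:Z + 1) = z (2 * n%:Z - 1) / (1 - B * z (2 * n%:Z - 1))
        & forall n : int, -1 <= n ->
            1 - (n + 1)%:~R * B * z (-1) != 0 /\
            z (2 * n + 1) =
              1 / - B * ((1 - (n + 2)%:~R * B * z (-1))
                         / (1 - (n + 1)%:~R * B * z (-1))) + 1 / B],
      (* (ii) *)
      z (-1) = 0 ->
      [/\ forall n : nat, z (2 * n%:Z + 1) = 0,
          forall n : nat, (1 <= n)%N -> 1 - B * z (2 * n%:Z - 2) != 0 /\
            z (2 * n%:Z) = z (2 * n%:Z - 2) / (1 - B * z (2 * n%:Z - 2))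
        & forall n : nat,
            1 - n%:R * B * z 0 != 0 /\
            z (2 * n%:Z) =
              1 / - B * ((1 - (n%:R + 1) * B * z 0)
                         / (1 - n%:R * B * z 0)) + 1 / B],
      (* (iii) *)
      z 0 = - 1 / B -> forall n : nat, z n%:Z = - 1 / B
    & (* (iv) *)
      z 0 != 0 -> z 0 != - 1 / B -> z (-1) != 0 ->
      let C := (1 / z 0 + B) * (1 / z (-1)) in
      [/\ forall n : nat, C * z n%:Z - B != 0 /\
            z (n%:Z + 1) = 1 / (C * z n%:Z - B),
          (* (a) *)
          ~ real_interval `[1 / 4, +oo[ (- C / B ^+ 2) ->
          let l1 := (1 - sqrtc (1 + 4 * C / B ^+ 2)) / 2 in
          let l2 := (1 + sqrtc (1 + 4 * C / B ^+ 2)) / 2 in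
          forall n : nat,
            let num := (B * l2 + C * z 0 - B) * l1 ^+ n.+1
                       + (B - C * z 0 - B * l1) * l2 ^+ n.+1 in
            let den := (B * l2 + C * z 0 - B) * l1 ^+ n
                       + (B - C * z 0 - B * l1) * l2 ^+ n in
            den != 0 /\ z n%:Z = - B / C * (num / den) + B / C,
          (* (b) *)
          - C / B ^+ 2 = 1 / 4 ->
          forall n : nat,
            let num := - B + (n%:R + 1) * (2 * C * z 0 - B) in
            let den := - 2 * B + 4 * n%:R * C * z 0 - 2 * n%:R * B in
            den != 0 /\ z n%:Z = - B / C * (num / den) + B / C
        & (* (c); the argument of acos is real *)
          real_interval `]1 / 4, +oo[ (- C / B ^+ 2) ->
          let D := B * sqrtc (- 4 * C / B ^+ 2 - 1) in
          let rho := acos (complex.Re (sqrtc (- B ^+ 2 / (4 * C)))) in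
          forall n : nat,
            let num := D * (cos (n.+1%:R * rho))%:C
                       + (B - 2 * C * z 0) * (sin (n.+1%:R * rho))%:C in
            let den := B * D * (cos (n%:R * rho))%:C
                       + (B ^+ 2 - 2 * C * B * z 0) * (sin (n%:R * rho))%:C in
            den != 0 /\
            z n%:Z = sqrtc (- B ^+ 2 / C) * (num / den) + B / C]].
Proof.
split; first by apply/seteqP; split; [exact: forbidden_set_sub | exact: sub_forbidden_set].
move=> z zs nf.
have c0E : z 0 != - 1 / B -> B * z 0 + 1 != 0 by rewrite neq_fixed_point.
split.
- have [/eqP|z0] := boolP (z 0 == 0); first by constructor 1.
  have [/eqP|z1] := boolP (z (-1) == 0); first by constructor 2.
  have [/eqP|zB] := boolP (z 0 == - 1 / B); first by constructor 3.
  by constructor 4.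
- exact: axis_closed_form.
- move=> z1.
  (* The shifted solution starts on the line of the previous case. *)
  pose y k := z (k + 1).
  have ys : is_solution B y.
    move=> n; rewrite /y subrK; have := zs n.+1.
    by rewrite -addn1 PoszD addrK.
  have st : step B (z 0, z (-1)) = Some (y 0, y (-1)).
    have := solution_orbit 1 zs nf; by rewrite /Defs.orbit /=.
  have ynf : ~ forbidden_set B (y 0, y (-1)).
    by move/(forbidden_step_Some st).
  have y0 : y 0 = 0 by rewrite /y (zs 0%N) z1 mul0r.
  have y1 : y (-1) = z 0 by [].
  have [e1 e2 e3] := axis_closed_form hB ys ynf y0; split=> n.
  + exact: e1.
  + case: n => [//|n _]; have [] := e2 n; rewrite /y.
    have -> : 2 * n%:Z + 1 + 1 = 2 * n.+1%:Z by lia.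
    by have -> : 2 * n%:Z - 1 + 1 = 2 * n.+1%:Z - 2 by lia.
  + have [|] := e3 (n%:Z - 1); first by lia.
    have -> : n%:Z - 1 + 2 = n.+1%:Z by lia.
    rewrite subrK y1 /y.
    have -> : 2 * (n%:Z - 1) + 1 + 1 = 2 * n%:Z by lia.
    by rewrite -!pmulrn -[n.+1%:R]natr1.
- move=> zB [//|n]; have z1 : z (-1) != 0.
    apply/eqP => z1; apply: nf; rewrite z1 zB.
    exact: fixed_line_start_forbidden.
  by have := solution_orbit n.+1 zs nf; rewrite [in LHS]zB fixed_line_orbit // => -[].
move=> z0 zB z1 C; pose d := C / B ^+ 2.
have [d0 F] := curve_solution hB zs nf z0 (c0E zB) z1.
rewrite -/C -/d in d0 F.
have CE : C = d * B ^+ 2 by rewrite /d; field.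
clearbody C; split.
- move=> n; have [q0 zn] := F n; have [q1 zn1] := F n.+1.
  have e : C * z n%:Z - B = - (B * denom B d (z 0) n.+1 / denom B d (z 0) n).
    by rewrite zn CE; field; rewrite q0 hB d0.
  rewrite e oppr_eq0 !mulf_neq0 ?invr_eq0 //; split=> //.
  have -> : n%:Z + 1 = n.+1%:Z by lia.
  rewrite zn1 /denom linrecSS -!/(denom _ _ _ _); field.
  by rewrite q0 q1 hB d0.
- move=> dI l1 l2 n num den; have [q0 zn] := F n.
  have [? e] := quotient_distinct_roots hB CE dI q0.
  by rewrite zn (quotient_form hB d0 CE) -e.
- move=> d4 n num den; have [q0 zn] := F n.
  have [? e] := quotient_double_root hB CE d4 q0.
  by rewrite zn (quotient_form hB d0 CE) -e.
move=> dI D rho n num den; have [q0 zn] := F n.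
have [? e] := quotient_conjugate_roots hB CE dI q0.
by rewrite zn (quotient_form hB d0 CE) -e.
Qed.
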